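(* Let $\mathcal M$ be a category satisfying the following conditions: (i) $\mathcal M$ has an initial object and a final object; (ii) $\mathcal M$ has finite coproducts and finite products; (iii) there is a model structure $(\mathrm{CoFib},\mathrm{Fib},\mathrm{Weq})$ on $\mathcal M$; (iv) for any trivial cofibration $i: A\to B$ and any morphism $u: A\to C$, there exists a weak push-out square of $u$ and $i$, with morphisms $i': C\to D$ and $B\to D$, such that $i'$ is also a trivial cofibration; (v) for any trivial fibration $p: C\to D$ and any morphism $v: B\to D$, there exists a weak pull-back square of $v$ and $p$, with morphisms $p': A\to B$ and $A\to C$, such that $p'$ is also a trivial fibration. Then the composition of the embedding $\mathcal M_{cf}\hookrightarrow\mathcal M$ and the localization functor $\mathcal M\to \mathrm{Ho}(\mathcal M)$ induces an equivalence $\pi\mathcal M_{cf}\cong \mathrm{Ho}(\mathcal M)$ of categories.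
   Context: A model structure on a category $\mathcal M$ is a triple $(\mathrm{CoFib},\mathrm{Fib},\mathrm{Weq})$ of classes of morphisms (cofibrations, fibrations, weak equivalences) satisfying: (Two out of three) if two of $\alpha,\beta,\beta\alpha$ are in $\mathrm{Weq}$ then so is the third; (Retract) each of the three classes is closed under retracts; (Lifting) every commutative square whose left vertical morphism $i$ is in $\mathrm{CoFib}$ and right vertical morphism $p$ is in $\mathrm{Fib}$ admits a lifting if $i\in\mathrm{Weq}$ or $p\in\mathrm{Weq}$; (Factorization) every morphism $f$ factors as $f=pi=qj$ with $i\in\mathrm{CoFib}\cap\mathrm{Weq}$, $p\in\mathrm{Fib}$, $j\in\mathrm{CoFib}$, $q\in\mathrm{Fib}\cap\mathrm{Weq}$. No existence of push-outs or pull-backs is assumed. Trivial cofibrations (trivial fibrations) are the morphisms in $\mathrm{CoFib}\cap\mathrm{Weq}$ (in $\mathrm{Fib}\cap\mathrm{Weq}$). An object $X$ is cofibrant if the morphism from the initial object to $X$ is a cofibration, and fibrant if the morphism from $X$ to the final object is a fibration. A commutative square with $v':Y'\to Z'$, $\alpha':Y'\to Y$, $v:Y\to Z$, $\alpha:Z'\to Z$, $v\alpha'=\alpha v'$, is a weak pull-back of $v$ and $\alpha$ if for any $f:W\to Y$, $g:W\to Z'$ with $vf=\alpha g$ there is a (not necessarily unique) $h:W\to Y'$ with $\alpha'h=f$, $v'h=g$; it is a weak push-out of $v'$ and $\alpha'$ if for any $f:Y\to W$, $g:Z'\to W$ with $f\alpha'=gv'$ there is a (not necessarily unique) $h:Z\to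 W$ with $hv=f$, $h\alpha=g$. $\mathrm{Ho}(\mathcal M)$ is the localization $\mathcal M[\mathrm{Weq}^{-1}]$. $\mathcal M_{cf}$ is the full subcategory of objects that are both cofibrant and fibrant. For $f,g:A\to B$, $f$ is left homotopic to $g$ if there are an object $\widetilde A$, a morphism $(\partial_0,\partial_1):A\sqcup A\to\widetilde A$, a weak equivalence $\sigma:\widetilde A\to A$ and a morphism $h:\widetilde A\to B$ with $\sigma\partial_0=\sigma\partial_1=\mathrm{Id}_A$, $h\partial_0=f$, $h\partial_1=g$; right homotopy is the dual notion. On $\mathcal M_{cf}$ left homotopy and right homotopy coincide and form an equivalence relation compatible with composition, denoted $\sim$, and $\pi\mathcal M_{cf}$ is the quotient category of $\mathcal M_{cf}$ by $\sim$. *)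

(* Defs.v *)
From mathcomp Require Import all_boot.
From mathcomp Require Import boolp.

Set Implicit Arguments.
Unset Strict Implicit.
Unset Printing Implicit Defensive.

#[local] Obligation Tactic := idtac.

Declare Scope cat_scope.
Delimit Scope cat_scope with cat.

Record category := Category {
  ob :> Type;
  hom : ob -> ob -> Type;
  idm : forall A, hom A A;
  comp : forall A B C, hom B C -> hom A B -> hom A C;
  comp1m : forall A B (f : hom A B), comp (idm B) f = f;
  compm1 : forall A B (f : hom A B), comp f (idm A) = f;
  compmA : forall A B C D (h : hom C D) (g : hom B C) (f : hom A B),
    comp h (comp g f) = comp (comp h g) f
}.
Arguments hom {c} A B.
Arguments idm {c} A.
Arguments comp {c A B C} g f.

Notation "g ∘ f" := (comp g f) (at level 40, left associativity) : cat_scope.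
Local Open Scope cat_scope.

Record functor (C D : category) := Functor {
  fob :> C -> D;
  fmap : forall A B, hom A B -> hom (fob A) (fob B);
  fmap_id : forall A, fmap (idm A) = idm (fob A);
  fmap_comp : forall A B E (g : hom B E) (f : hom A B),
    fmap (g ∘ f) = fmap g ∘ fmap f
}.
Arguments fmap {C D} _ {A B} _.

Definition functor_id (C : category) : functor C C :=
  @Functor C C id (fun A B f => f) (fun A => erefl) (fun A B E g f => erefl).

Program Definition functor_comp (C D E : category) (G : functor D E)
    (F : functor C D) : functor C E :=
  @Functor C E (fun A => G (F A)) (fun A B f => fmap G (fmap F f)) _ _.
Next Obligation. by move=> C D E G F A /=; rewrite !fmap_id. Qed.
Next Obligation. by move=> C D E G F A B X g f /=; rewrite !fmap_comp. Qed.

Definition is_iso (C : category) (A B : C) (f : hom A B) : Prop :=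
  exists g : hom B A, g ∘ f = idm A /\ f ∘ g = idm B.

Definition naturally_isomorphic (C D : category) (F G : functor C D) : Prop :=
  exists t : forall A : C, hom (F A) (G A),
    (forall A, is_iso (t A)) /\
    (forall A B (f : hom A B), t B ∘ fmap F f = fmap G f ∘ t A).

Definition is_equivalence (C D : category) (F : functor C D) : Prop :=
  exists G : functor D C,
    naturally_isomorphic (functor_comp G F) (functor_id C) /\
    naturally_isomorphic (functor_comp F G) (functor_id D).

Definition full_subcategory (C : category) (P : C -> Prop) : category :=
  @Category {X : C | P X} (fun X Y => hom (sval X) (sval Y))
    (fun X => idm (sval X)) (fun X Y Z g f => g ∘ f)
    (fun X Y f => comp1m f) (fun X Y f => compm1 f)
    (fun X Y Z T h g f => compmA h g f).

Definition full_inclusion (C : category) (P : C -> Prop) :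
    functor (full_subcategory P) C :=
  @Functor (full_subcategory P) C sval (fun X Y f => f)
    (fun X => erefl) (fun X Y Z g f => erefl).

Record congruence (C : category) := Congruence {
  cong : forall A B : C, hom A B -> hom A B -> Prop;
  cong_refl : forall A B (f : hom A B), cong f f;
  cong_sym : forall A B (f g : hom A B), cong f g -> cong g f;
  cong_trans : forall A B (f g h : hom A B), cong f g -> cong g h -> cong f h;
  cong_comp : forall A B D (g g' : hom B D) (f f' : hom A B),
    cong g g' -> cong f f' -> cong (g ∘ f) (g' ∘ f')
}.

Section Quotient.
Local Open Scope quotient_scope.

Definition congb (C : category) (R : congruence C) (A B : C) :
  rel {classic hom A B} := fun f g => `[< cong R f g >].

Lemma congb_refl (C : category) (R : congruence C) (A B : C) :
  reflexive (congb R (A := A) (B := B)).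
Proof. by move=> f; apply/asboolP/cong_refl. Qed.

Lemma congb_sym (C : category) (R : congruence C) (A B : C) :
  symmetric (congb R (A := A) (B := B)).
Proof. by move=> f g; apply/asboolP/asboolP => /cong_sym. Qed.

Lemma congb_trans (C : category) (R : congruence C) (A B : C) :
  transitive (congb R (A := A) (B := B)).
Proof.
by move=> g f h /asboolP fg /asboolP gh; apply/asboolP/(cong_trans fg gh).
Qed.

Canonical cong_equiv (C : category) (R : congruence C) (A B : C) :
    equiv_rel {classic hom A B} :=
  EquivRel (congb R (A := A) (B := B)) (@congb_refl C R A B)
    (@congb_sym C R A B) (@congb_trans C R A B).

Definition quotient_hom (C : category) (R : congruence C) (A B : C) : Type :=
  {eq_quot cong_equiv R A B}.

Definition quotient_class (C : category) (R : congruence C) (A B : C)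
    (f : hom A B) : quotient_hom R A B :=
  \pi_({eq_quot cong_equiv R A B}) f.

Definition quotient_repr (C : category) (R : congruence C) (A B : C)
    (f : quotient_hom R A B) : hom A B :=
  repr (f : {eq_quot cong_equiv R A B}).

Lemma quotient_reprK (C : category) (R : congruence C) (A B : C)
  (f : quotient_hom R A B) : quotient_class R (quotient_repr f) = f.
Proof. exact: reprK. Qed.

Lemma quotient_classP (C : category) (R : congruence C) (A B : C)
  (f g : hom A B) : quotient_class R f = quotient_class R g <-> cong R f g.
Proof.
split=> [/(@eqmodP _ (cong_equiv R A B)) /asboolP //|fg].
by apply/(@eqmodP _ (cong_equiv R A B))/asboolP.
Qed.

Lemma quotient_classK (C : category) (R : congruence C) (A B : C)
  (f : hom A B) : cong R (quotient_repr (quotient_class R f)) f.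
Proof. by apply/quotient_classP; rewrite quotient_reprK. Qed.

End Quotient.

Program Definition quotient_category (C : category) (R : congruence C) :
    category :=
  @Category C (quotient_hom R) (fun A => quotient_class R (idm A))
    (fun A B D g f => quotient_class R (quotient_repr g ∘ quotient_repr f))
    _ _ _.
Next Obligation.
move=> C R A B f; rewrite -[RHS]quotient_reprK; apply/quotient_classP.
rewrite -[X in cong R _ X]comp1m.
by apply: cong_comp; [apply: quotient_classK|apply: cong_refl].
Qed.
Next Obligation.
move=> C R A B f; rewrite -[RHS]quotient_reprK; apply/quotient_classP.
rewrite -[X in cong R _ X]compm1.
by apply: cong_comp; [apply: cong_refl|apply: quotient_classK].
Qed.
Next Obligation.
move=> C R A B D E h g f; apply/quotient_classP.
apply: (cong_trans (cong_comp (cong_refl R _) (quotient_classK R _))).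
rewrite compmA; apply/cong_sym.
exact: cong_comp (quotient_classK R _) (cong_refl R _).
Qed.

Program Definition quotient_functor (C : category) (R : congruence C) :
    functor C (quotient_category R) :=
  @Functor C (quotient_category R) id (fun A B f => quotient_class R f) _ _.
Next Obligation. by []. Qed.
Next Obligation.
move=> C R A B D g f; apply/quotient_classP/cong_sym.
exact: cong_comp (quotient_classK R _) (quotient_classK R _).
Qed.

Definition respects (C D : category) (R : congruence C) (F : functor C D) :
    Prop :=
  forall (A B : C) (f g : hom A B), cong R f g -> fmap F f = fmap F g.

Program Definition induced_functor (C D : category) (R : congruence C)
    (F : functor C D) (FR : respects R F) : functor (quotient_category R) D :=
  @Functor (quotient_category R) D (fob F)
    (fun A B f => fmap F (quotient_repr f)) _ _.
Next Obligation.
by move=> C D R F FR A /=; rewrite (FR _ _ _ _ (quotient_classK R _)) fmap_id.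
Qed.
Next Obligation.
move=> C D R F FR A B E g f /=.
by rewrite (FR _ _ _ _ (quotient_classK R _)) fmap_comp.
Qed.

Lemma induced_functorE (C D : category) (R : congruence C) (F : functor C D)
    (FR : respects R F) (A B : C) (f : hom A B) :
  fmap (induced_functor FR) (fmap (quotient_functor R) f) = fmap F f.
Proof. exact: FR _ _ _ _ (quotient_classK R f). Qed.

Record initial_object (C : category) := InitialObject {
  initial_ob :> C;
  from_initial : forall X, hom initial_ob X;
  from_initial_uniq : forall X (f : hom initial_ob X), f = from_initial X
}.

Record final_object (C : category) := FinalObject {
  final_ob :> C;
  to_final : forall X, hom X final_ob;
  to_final_uniq : forall X (f : hom X final_ob), f = to_final X
}.

Definition is_coproduct (C : category) (I : Type) (X : I -> C) (S : C)
    (inj : forall i, hom (X i) S) : Prop :=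
  forall (W : C) (f : forall i, hom (X i) W),
    exists! h : hom S W, forall i, h ∘ inj i = f i.

Definition is_product (C : category) (I : Type) (X : I -> C) (P : C)
    (prj : forall i, hom P (X i)) : Prop :=
  forall (W : C) (f : forall i, hom W (X i)),
    exists! h : hom W P, forall i, prj i ∘ h = f i.

Definition has_finite_coproducts (C : category) : Prop :=
  forall (I : finType) (X : I -> C),
    exists (S : C) (inj : forall i, hom (X i) S), is_coproduct inj.

Definition has_finite_products (C : category) : Prop :=
  forall (I : finType) (X : I -> C),
    exists (P : C) (prj : forall i, hom P (X i)), is_product prj.

(* In both definitions the square is  v ∘ a' = a ∘ v'. *)
Definition weak_pullback (C : category) (Y' Z' Y Z : C) (v' : hom Y' Z')
    (a' : hom Y' Y) (v : hom Y Z) (a : hom Z' Z) : Prop :=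
  v ∘ a' = a ∘ v' /\
  forall (W : C) (f : hom W Y) (g : hom W Z'), v ∘ f = a ∘ g ->
    exists h : hom W Y', a' ∘ h = f /\ v' ∘ h = g.

Definition weak_pushout (C : category) (Y' Z' Y Z : C) (v' : hom Y' Z')
    (a' : hom Y' Y) (v : hom Y Z) (a : hom Z' Z) : Prop :=
  v ∘ a' = a ∘ v' /\
  forall (W : C) (f : hom Y W) (g : hom Z' W), f ∘ a' = g ∘ v' ->
    exists h : hom Z W, h ∘ v = f /\ h ∘ a = g.

Definition mor_class (C : category) := forall A B : C, hom A B -> Prop.

Definition is_retract (C : category) (A B X Y : C) (f : hom A B)
    (g : hom X Y) : Prop :=
  exists (i : hom A X) (r : hom X A) (j : hom B Y) (s : hom Y B),
    [/\ r ∘ i = idm A, s ∘ j = idm B, g ∘ i = j ∘ f & f ∘ r = s ∘ g].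

Definition retract_closed (C : category) (K : mor_class C) : Prop :=
  forall (A B X Y : C) (f : hom A B) (g : hom X Y),
    is_retract f g -> K _ _ g -> K _ _ f.

Definition has_lifting (C : category) (A B X Y : C) (i : hom A B)
    (p : hom X Y) : Prop :=
  forall (u : hom A X) (v : hom B Y), p ∘ u = v ∘ i ->
    exists h : hom B X, h ∘ i = u /\ p ∘ h = v.

Record model_structure (M : category) := ModelStructure {
  CoFib : mor_class M;
  Fib : mor_class M;
  Weq : mor_class M;
  weq_comp : forall (A B C : M) (a : hom A B) (b : hom B C),
    Weq a -> Weq b -> Weq (b ∘ a);
  weq_cancell : forall (A B C : M) (a : hom A B) (b : hom B C),
    Weq b -> Weq (b ∘ a) -> Weq a;
  weq_cancelr : forall (A B C : M) (a : hom A B) (b : hom B C),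
    Weq a -> Weq (b ∘ a) -> Weq b;
  cofib_retract : retract_closed CoFib;
  fib_retract : retract_closed Fib;
  weq_retract : retract_closed Weq;
  model_lifting : forall (A B X Y : M) (i : hom A B) (p : hom X Y),
    CoFib i -> Fib p -> Weq i \/ Weq p -> has_lifting i p;
  model_factor_tcof : forall (A B : M) (f : hom A B),
    exists (E : M) (i : hom A E) (p : hom E B),
      [/\ f = p ∘ i, CoFib i, Weq i & Fib p];
  model_factor_tfib : forall (A B : M) (f : hom A B),
    exists (E : M) (j : hom A E) (q : hom E B),
      [/\ f = q ∘ j, CoFib j, Fib q & Weq q]
}.

Definition trivial_cofibration (M : category) (S : model_structure M)
    (A B : M) (f : hom A B) : Prop := CoFib S f /\ Weq S f.

Definition trivial_fibration (M : category) (S : model_structure M)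
    (A B : M) (f : hom A B) : Prop := Fib S f /\ Weq S f.

Definition cofibrant (M : category) (I0 : initial_object M)
    (S : model_structure M) (X : M) : Prop := CoFib S (from_initial I0 X).

Definition fibrant (M : category) (F0 : final_object M)
    (S : model_structure M) (X : M) : Prop := Fib S (to_final F0 X).

Definition cf_category (M : category) (I0 : initial_object M)
    (F0 : final_object M) (S : model_structure M) : category :=
  full_subcategory (fun X : M => cofibrant I0 S X /\ fibrant F0 S X).

Definition cf_inclusion (M : category) (I0 : initial_object M)
    (F0 : final_object M) (S : model_structure M) :
    functor (cf_category I0 F0 S) M :=
  @full_inclusion M (fun X : M => cofibrant I0 S X /\ fibrant F0 S X).

(* The morphism (d0, d1) from the coproduct of A with itself is given by its
   two components; it is not required to be a cofibration. *)
Definition left_homotopic (M : category) (S : model_structure M) (A B : M)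
    (f g : hom A B) : Prop :=
  exists (At : M) (d0 d1 : hom A At) (s : hom At A) (h : hom At B),
    [/\ Weq S s, s ∘ d0 = idm A, s ∘ d1 = idm A, h ∘ d0 = f & h ∘ d1 = g].

Definition right_homotopic (M : category) (S : model_structure M) (A B : M)
    (f g : hom A B) : Prop :=
  exists (Bt : M) (d0 d1 : hom Bt B) (s : hom B Bt) (h : hom A Bt),
    [/\ Weq S s, d0 ∘ s = idm B, d1 ∘ s = idm B, d0 ∘ h = f & d1 ∘ h = g].

Lemma weq_id (M : category) (S : model_structure M) (A : M) : Weq S (idm A).
Proof.
have [E [i [p [e _ wi _]]]] := model_factor_tcof S (idm A).
apply: (weq_retract (X := A) (Y := E) (g := i)) wi.
exists (idm A), (idm A), i, p.
by rewrite -e !compm1.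
Qed.

Lemma cofib_llp (M : category) (S : model_structure M) (A B : M)
    (i : hom A B) :
  (forall (X Y : M) (p : hom X Y), Fib S p -> Weq S p -> has_lifting i p) ->
  CoFib S i.
Proof.
move=> llp; have [E [j [q [e cj fq wq]]]] := model_factor_tfib S i.
have [|h [hi qh]] := llp _ _ q fq wq j (idm B); first by rewrite comp1m e.
apply: (cofib_retract (g := j)) cj.
by exists (idm A), (idm A), h, q; split; rewrite ?compm1 ?hi -?e.
Qed.

Lemma good_left_homotopy (M : category) (I0 : initial_object M)
    (S : model_structure M) (A B : M) (f g : hom A B) :
  has_finite_coproducts M -> cofibrant I0 S A -> left_homotopic S f g ->
  exists (At : M) (d0 d1 : hom A At) (s : hom At A) (h : hom At B),
    [/\ s ∘ d0 = idm A, s ∘ d1 = idm A, h ∘ d0 = f, h ∘ d1 = g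
      & CoFib S d1 /\ Weq S d1].
Proof.
move=> hcop cA [At [d0 [d1 [s [h [ws sd0 sd1 hd0 hd1]]]]]].
have [T [inj cop]] := hcop bool (fun=> A).
have [d [de _]] := cop At (fun b => if b then d1 else d0).
have [E [j [q [e cj fq wq]]]] := model_factor_tfib S d.
exists E, (j ∘ inj false), (j ∘ inj true), (s ∘ q), (h ∘ q).
have qj b : q ∘ (j ∘ inj b) = if b then d1 else d0 by rewrite compmA -e de.
split; rewrite -?compmA ?qj //.
split; last first.
  apply: (weq_cancell (b := s ∘ q)); first exact: weq_comp wq ws.
  by rewrite -compmA qj sd1; apply: weq_id.
apply: cofib_llp => X Y p fp wp u v pu.
have [|w [_ pw]] := model_lifting cA fp (or_intror wp)
  (u := from_initial I0 X) (v := v ∘ (j ∘ inj false)).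
  by rewrite (from_initial_uniq (p ∘ _)) [RHS]from_initial_uniq.
have [c [ce _]] := cop X (fun b => if b then u else w).
have pc : p ∘ c = v ∘ j.
  have [k [_ ku]] := cop Y (fun b => v ∘ (j ∘ inj b)).
  rewrite -(ku (v ∘ j)); last by move=> b; rewrite compmA.
  by rewrite -(ku (p ∘ c)) // => -[]; rewrite -compmA ce.
have [t [tj pt]] := model_lifting cj fp (or_intror wp) pc.
by exists t; rewrite compmA tj ce pt.
Qed.

Lemma good_path_object (M : category) (S : model_structure M) (B : M) :
  has_finite_products M ->
  exists (P : M) (p0 p1 : hom P B) (c : hom B P),
    [/\ Weq S c, p0 ∘ c = idm B, p1 ∘ c = idm B
      & forall (X Y : M) (i : hom X Y) (u : hom X P) (v0 v1 : hom Y B),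
          trivial_cofibration S i -> p0 ∘ u = v0 ∘ i -> p1 ∘ u = v1 ∘ i ->
          exists l : hom Y P, [/\ l ∘ i = u, p0 ∘ l = v0 & p1 ∘ l = v1]].
Proof.
move=> hprod; have [Q [prj prod]] := hprod bool (fun=> B).
have [d [de _]] := prod B (fun=> idm B).
have [P [c [p [e cc wc fp]]]] := model_factor_tcof S d.
exists P, (prj false ∘ p), (prj true ∘ p), c.
split; rewrite -?compmA -?e //.
move=> X Y i u v0 v1 [ci wi] e0 e1.
have [v [ve _]] := prod Y (fun b => if b then v1 else v0).
have pu : p ∘ u = v ∘ i.
  have [k [_ ku]] := prod X (fun b => prj b ∘ (v ∘ i)).
  rewrite -(ku (v ∘ i)) // -(ku (p ∘ u)) // => -[]; rewrite !compmA ve //.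
have [l [li pl]] := model_lifting ci fp (or_introl wi) pu.
by exists l; split; rewrite // -compmA pl ve.
Qed.

Lemma left_to_right_homotopic (M : category) (I0 : initial_object M)
    (S : model_structure M) (A B : M) (f g : hom A B) :
  has_finite_coproducts M -> has_finite_products M -> cofibrant I0 S A ->
  left_homotopic S f g -> right_homotopic S f g.
Proof.
move=> hcop hprod cA /(good_left_homotopy hcop cA).
move=> [At [d0 [d1 [s [h [sd0 sd1 hd0 hd1 [c1 w1]]]]]]].
have [P [p0 [p1 [c [wc p0c p1c lift]]]]] := good_path_object S B hprod.
have [||l [l1 pl0 pl1]] := lift _ _ _ (c ∘ g) h (g ∘ s) (conj c1 w1).
- by rewrite compmA p0c comp1m hd1.
- by rewrite compmA p1c -compmA sd1 comp1m compm1.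
exists P, p0, p1, c, (l ∘ d0); split => //.
- by rewrite compmA pl0.
- by rewrite compmA pl1 -compmA sd0 compm1.
Qed.

Definition opposite (C : category) : category :=
  @Category C (fun A B => @hom C B A) (fun A => idm A)
    (fun A B D g f => @comp C D B A f g)
    (fun A B f => compm1 f) (fun A B f => comp1m f)
    (fun A B D E h g f => esym (@compmA C E D B A f g h)).

Definition opposite_initial (C : category) (F0 : final_object C) :
    initial_object (opposite C) :=
  @InitialObject (opposite C) F0 (to_final F0) (@to_final_uniq C F0).

Lemma opposite_retract_closed (C : category) (K : mor_class C) :
  retract_closed K ->
  retract_closed (C := opposite C) (fun A B f => @K B A f).
Proof.
move=> rK A B X Y f g [i [r [j [s [ri sj gi fr]]]]].
by apply: rK; exists s, j, r, i; split.
Qed.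

Program Definition opposite_model (M : category) (S : model_structure M) :
    model_structure (opposite M) :=
  @ModelStructure (opposite M) (fun A B f => @Fib M S B A f)
    (fun A B f => @CoFib M S B A f) (fun A B f => @Weq M S B A f)
    _ _ _ (opposite_retract_closed (@fib_retract _ S))
    (opposite_retract_closed (@cofib_retract _ S))
    (opposite_retract_closed (@weq_retract _ S)) _ _ _.
Next Obligation. by move=> M S A B D a b wa wb; apply: weq_comp wb wa. Qed.
Next Obligation. by move=> M S A B D a b wb; apply: weq_cancelr wb. Qed.
Next Obligation. by move=> M S A B D a b wa; apply: weq_cancell wa. Qed.
Next Obligation.
move=> M S A B X Y i p fi cp w u v e.
have [h [h1 h2]] := model_lifting cp fi (proj1 (or_comm _ _) w) (esym e).
by exists h.
Qed.
Next Obligation.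
move=> M S A B f; have [E [j [q [e cj fq wq]]]] := model_factor_tfib S f.
by exists E, q, j.
Qed.
Next Obligation.
move=> M S A B f; have [E [j [q [e cj wj fq]]]] := model_factor_tcof S f.
by exists E, q, j.
Qed.

Lemma right_to_left_homotopic (M : category) (F0 : final_object M)
    (S : model_structure M) (A B : M) (f g : hom A B) :
  has_finite_coproducts M -> has_finite_products M -> fibrant F0 S B ->
  right_homotopic S f g -> left_homotopic S f g.
Proof.
move=> hcop hprod fB.
exact: (@left_to_right_homotopic (opposite M) (opposite_initial F0)
          (opposite_model S) B A f g hprod hcop fB).
Qed.

Lemma left_homotopic_refl (M : category) (S : model_structure M) (A B : M)
  (f : hom A B) : left_homotopic S f f.
Proof.
by exists A, (idm A), (idm A), (idm A), f; rewrite comp1m compm1;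
  split=> //; apply: weq_id.
Qed.

Lemma left_homotopic_sym (M : category) (S : model_structure M) (A B : M)
  (f g : hom A B) : left_homotopic S f g -> left_homotopic S g f.
Proof.
by move=> [At [d0 [d1 [s [h [? ? ? ? ?]]]]]]; exists At, d1, d0, s, h.
Qed.

Lemma left_homotopic_postcomp (M : category) (S : model_structure M)
    (A B C : M) (k : hom B C) (f g : hom A B) :
  left_homotopic S f g -> left_homotopic S (k ∘ f) (k ∘ g).
Proof.
move=> [At [d0 [d1 [s [h [? ? ? hf hg]]]]]].
by exists At, d0, d1, s, (k ∘ h); rewrite -!compmA hf hg.
Qed.

Lemma right_homotopic_precomp (M : category) (S : model_structure M)
    (A B C : M) (k : hom A B) (f g : hom B C) :
  right_homotopic S f g -> right_homotopic S (f ∘ k) (g ∘ k).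
Proof.
move=> [Ct [d0 [d1 [s [h [? ? ? hf hg]]]]]].
by exists Ct, d0, d1, s, (h ∘ k); rewrite !compmA hf hg.
Qed.

Lemma left_homotopic_trans (M : category) (I0 : initial_object M)
    (F0 : final_object M) (S : model_structure M) (A B : M)
    (f g h : hom A B) :
  has_finite_coproducts M -> has_finite_products M ->
  cofibrant I0 S A -> fibrant F0 S B ->
  left_homotopic S f g -> left_homotopic S g h -> left_homotopic S f h.
Proof.
move=> hcop hprod cA fB fg gh.
apply: (right_to_left_homotopic hcop hprod fB).
have [At [d0 [d1 [s [k [sd0 sd1 kd0 kd1 [c1 w1]]]]]]] :=
  good_left_homotopy hcop cA fg.
have [Ah [e0 [e1 [r [m [re0 re1 me0 me1 [c2 w2]]]]]]] :=
  good_left_homotopy hcop cA (left_homotopic_sym gh).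
have [P [p0 [p1 [c [wc p0c p1c lift]]]]] := good_path_object S B hprod.
have [||l [l1 pl0 pl1]] := lift _ _ _ (c ∘ g) m (g ∘ r) (conj c2 w2).
- by rewrite compmA p0c comp1m me1.
- by rewrite compmA p1c -compmA re1 comp1m compm1.
have [||t [t1 pt0 pt1]] := lift _ _ _ (l ∘ e0) (h ∘ s) k (conj c1 w1).
- by rewrite compmA pl0 me0 -compmA sd1 compm1.
- by rewrite compmA pl1 kd1 -compmA re0 compm1.
exists P, p1, p0, c, (t ∘ d0); split => //.
- by rewrite compmA pt1.
- by rewrite compmA pt0 -compmA sd0 compm1.
Qed.

Section HomotopyCategory.
Context (M : category) (I0 : initial_object M) (F0 : final_object M).
Context (hcop : has_finite_coproducts M) (hprod : has_finite_products M).
Context (S : model_structure M).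

Lemma left_right_homotopicP (A B : cf_category I0 F0 S)
    (f g : @hom M (sval A) (sval B)) :
  left_homotopic S f g <-> right_homotopic S f g.
Proof.
split; first exact: left_to_right_homotopic hcop hprod (proj1 (svalP A)).
exact: right_to_left_homotopic hcop hprod (proj2 (svalP B)).
Qed.

Program Definition homotopy_congruence : congruence (cf_category I0 F0 S) :=
  @Congruence (cf_category I0 F0 S)
    (fun A B f g => @left_homotopic M S (sval A) (sval B) f g) _ _ _ _.
Next Obligation. by move=> A B f; apply: left_homotopic_refl. Qed.
Next Obligation. by move=> A B f g; apply: left_homotopic_sym. Qed.
Next Obligation.
move=> A B f g h.
exact: left_homotopic_trans hcop hprod (proj1 (svalP A)) (proj2 (svalP B)).
Qed.
Next Obligation.
move=> A B D g g' f f' gg ff.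
apply: (left_homotopic_trans hcop hprod (proj1 (svalP A)) (proj2 (svalP D))
  (g := (g : @hom M (sval B) (sval D)) ∘ f')).
  exact: left_homotopic_postcomp ff.
apply: (right_to_left_homotopic hcop hprod (proj2 (svalP D))).
apply: right_homotopic_precomp.
exact: left_to_right_homotopic hcop hprod (proj1 (svalP B)) gg.
Qed.

Definition pi_cf : category := quotient_category homotopy_congruence.

End HomotopyCategory.

Definition inverts (C D : category) (W : mor_class C) (F : functor C D) : Prop :=
  forall (A B : C) (f : hom A B), W A B f -> is_iso (fmap F f).

(* Strict (Gabriel-Zisman) universal property: an equality, not a natural
   isomorphism, of functors. *)
Definition is_localization (C L : category) (W : mor_class C)
    (loc : functor C L) : Prop :=
  inverts W loc /\
  forall (D : category) (F : functor C D), inverts W F ->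
    exists! G : functor L D, functor_comp G loc = F.

(* Existence of localizations: zigzags modulo the congruence generated by
   functoriality and by the formal inverses. *)

Definition total_arrow (D : category) := {A : D & {B : D & hom A B}}.

Definition arrow (D : category) (A B : D) (f : hom A B) : total_arrow D :=
  existT _ A (existT _ B f).

Lemma existT_inj (T : Type) (P : T -> Type) (x : T) (u v : P x) :
  existT P x u = existT P x v -> u = v.
Proof.
move=> e; have h (w : {y & P y}) (E : existT P x u = w) :
    forall E' : x = projT1 w, eq_rect x P u _ E' = projT2 w.
  by case: _ / E => /= E'; rewrite (Prop_irrelevance E' erefl).
exact: (h _ e erefl).
Qed.

Lemma functorP (C D : category) (F G : functor C D) :
  (forall (A B : C) (f : hom A B), arrow (fmap F f) = arrow (fmap G f)) ->
  F = G.
Proof.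
case: F G => [oF mF iF cF] [oG mG iG cG] /= e.
have eo : oF = oG by apply/funext => A; apply: (f_equal (@projT1 _ _) (e _ _ (idm A))).
case: _ / eo in mG iG cG e *.
have em : mF = mG.
  do 3 (apply: functional_extensionality_dep => ?).
  exact: (existT_inj (existT_inj (e _ _ _))).
case: _ / em in iG cG e *.
by rewrite (Prop_irrelevance iF iG) (Prop_irrelevance cF cG).
Qed.

Lemma arrow_fmap (C D : category) (F G : functor C D) (A B : C) (f : hom A B) :
  F = G -> arrow (fmap F f) = arrow (fmap G f).
Proof. by move=> ->. Qed.

Inductive zigzag (C : category) (W : mor_class C) (A : C) : C -> Type :=
| zz_nil : zigzag W A A
| zz_fwd B D : hom B D -> zigzag W A B -> zigzag W A D
| zz_bwd B D (f : hom D B) : W D B f -> zigzag W A B -> zigzag W A D.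
Arguments zz_nil {C W A}.

Fixpoint zz_cat (C : category) (W : mor_class C) (A B D : C)
    (q : zigzag W B D) (p : zigzag W A B) : zigzag W A D :=
  match q with
  | zz_nil => p
  | zz_fwd _ _ f q' => zz_fwd f (zz_cat q' p)
  | zz_bwd _ _ _ Wf q' => zz_bwd Wf (zz_cat q' p)
  end.

Lemma zz_cat0 (C : category) (W : mor_class C) (A B : C) (p : zigzag W A B) :
  zz_cat p zz_nil = p.
Proof. by elim: p => //= [B' D f p ->|B' D f Wf p ->]. Qed.

Lemma zz_catA (C : category) (W : mor_class C) (A B D E : C)
    (r : zigzag W D E) (q : zigzag W B D) (p : zigzag W A B) :
  zz_cat r (zz_cat q p) = zz_cat (zz_cat r q) p.
Proof. by elim: r q => //= [X Y f r IH|X Y f Wf r IH] q; rewrite IH. Qed.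

Definition zigzag_category (C : category) (W : mor_class C) : category :=
  @Category C (@zigzag C W) (fun A => zz_nil) (@zz_cat C W)
    (fun A B p => erefl) (@zz_cat0 C W) (@zz_catA C W).

Definition zz1 (C : category) (W : mor_class C) (A B : C) (f : hom A B) :
  zigzag W A B := zz_fwd f zz_nil.

Definition zzV (C : category) (W : mor_class C) (A B : C) (f : hom A B)
  (Wf : W A B f) : zigzag W B A := zz_bwd Wf zz_nil.

Inductive zz_eqv (C : category) (W : mor_class C) :
    forall A B : C, zigzag W A B -> zigzag W A B -> Prop :=
| zz_refl A B p : @zz_eqv C W A B p p
| zz_sym A B p q : @zz_eqv C W A B p q -> zz_eqv q p
| zz_trans A B p q r : @zz_eqv C W A B p q -> zz_eqv q r -> zz_eqv p r
| zz_comp A B D q q' p p' :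
    @zz_eqv C W B D q q' -> @zz_eqv C W A B p p' ->
    zz_eqv (zz_cat q p) (zz_cat q' p')
| zz_id A : zz_eqv (zz1 W (idm A)) zz_nil
| zz_fcomp A B D (g : hom B D) (f : hom A B) :
    zz_eqv (zz1 W (g ∘ f)) (zz_cat (zz1 W g) (zz1 W f))
| zz_invl A B (f : hom A B) (Wf : W A B f) :
    zz_eqv (zz_cat (zzV Wf) (zz1 W f)) zz_nil
| zz_invr A B (f : hom A B) (Wf : W A B f) :
    zz_eqv (zz_cat (zz1 W f) (zzV Wf)) zz_nil.

Definition zz_congruence (C : category) (W : mor_class C) :
    congruence (zigzag_category W) :=
  @Congruence (zigzag_category W) (@zz_eqv C W) (@zz_refl C W) (@zz_sym C W)
    (@zz_trans C W) (@zz_comp C W).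

Definition localization (C : category) (W : mor_class C) : category :=
  quotient_category (zz_congruence W).

Program Definition localization_functor (C : category) (W : mor_class C) :
    functor C (localization W) :=
  @Functor C (localization W) id
    (fun A B f => quotient_class (zz_congruence W) (zz1 W f)) _ _.
Next Obligation. by move=> C W A; apply/quotient_classP/zz_id. Qed.
Next Obligation.
move=> C W A B D g f; rewrite -[RHS](fmap_comp (quotient_functor _)).
exact/quotient_classP/zz_fcomp.
Qed.

Section LocalizationUMP.
Context (C D : category) (W : mor_class C) (F : functor C D).
Context (FW : inverts W F).

Definition zz_inv (A B : C) (f : hom A B) (Wf : W f) : hom (F B) (F A) :=
  sval (cid (FW Wf)).

Fixpoint zz_eval (A B : C) (p : zigzag W A B) : hom (F A) (F B) :=
  match p with
  | zz_nil => idm (F A)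
  | zz_fwd _ _ f q => fmap F f ∘ zz_eval q
  | zz_bwd _ _ _ Wf q => zz_inv Wf ∘ zz_eval q
  end.

Lemma zz_eval_cat (A B E : C) (q : zigzag W B E) (p : zigzag W A B) :
  zz_eval (zz_cat q p) = zz_eval q ∘ zz_eval p.
Proof.
elim: q p => /= [|X Y f q IH|X Y f Wf q IH] p; first by rewrite comp1m.
  by rewrite IH compmA.
by rewrite IH compmA.
Qed.

Definition zz_functor : functor (zigzag_category W) D :=
  @Functor (zigzag_category W) D F zz_eval (fun A => erefl)
    (fun A B E q p => zz_eval_cat q p).

Lemma zz_functor_respects : respects (zz_congruence W) zz_functor.
Proof.
move=> A B p q /=; elim=> //= {A B p q}.
- by move=> A B p q r _ -> _ ->.
- by move=> A B E q q' p p' _ eq _ ep; rewrite !zz_eval_cat eq ep.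
- by move=> A; rewrite fmap_id compm1.
- by move=> A B E g f; rewrite fmap_comp !compm1.
- by move=> A B f Wf; rewrite !compm1 /zz_inv; case: cid => g [].
- by move=> A B f Wf; rewrite !compm1 /zz_inv; case: cid => g [].
Qed.
End LocalizationUMP.

Lemma iso_inv_uniq (C : category) (A B : C) (f : hom A B) (g g' : hom B A) :
  g ∘ f = idm A -> f ∘ g' = idm B -> g = g'.
Proof. by move=> gf fg; rewrite -[g]compm1 -fg compmA gf comp1m. Qed.

Lemma zz_cancel (C : category) (W : mor_class C) (A B : C) (f : hom A B)
    (Wf : W A B f) :
  let fV : @hom (zigzag_category W) B A := zzV Wf in
  let Q := quotient_functor (zz_congruence W) in
  fmap Q fV ∘ fmap (localization_functor W) f = idm _ /\
  fmap (localization_functor W) f ∘ fmap Q fV = idm _.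
Proof.
move=> fV Q.
split; rewrite -[LHS](fmap_comp Q); apply/quotient_classP.
  exact: zz_invl.
exact: zz_invr.
Qed.

Lemma localization_uniq (C D : category) (W : mor_class C)
    (G G' : functor (localization W) D) :
  functor_comp G (localization_functor W)
    = functor_comp G' (localization_functor W) -> G = G'.
Proof.
move=> e; have eo : fob G = fob G' := f_equal (@fob _ _) e.
case: G G' e eo => [oG mG iG cG] [oG' mG' iG' cG'] /= e eo.
case: _ / eo in mG' iG' cG' e *.
have eloc A B (f : @hom C A B) : mG _ _ (fmap (localization_functor W) f)
    = mG' _ _ (fmap (localization_functor W) f).
  exact: existT_inj (existT_inj (arrow_fmap f e)).
pose Q := quotient_functor (zz_congruence W).
have eQ A B (p : @hom (zigzag_category W) A B) :
    mG _ _ (fmap Q p) = mG' _ _ (fmap Q p).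
  elim: p => [|X Y f p IH|X Y f Wf p IH].
  - by rewrite -[zz_nil]/(idm (c := zigzag_category W) A) fmap_id iG iG'.
  - have -> : fmap Q (zz_fwd f p : @hom (zigzag_category W) A Y)
        = fmap (localization_functor W) f ∘ fmap Q p.
      exact: (fmap_comp Q (zz1 W f) p).
    by rewrite cG cG' IH eloc.
  - have -> : fmap Q (zz_bwd Wf p : @hom (zigzag_category W) A Y)
        = fmap Q (zzV Wf : @hom (zigzag_category W) X Y) ∘ fmap Q p.
      exact: (fmap_comp Q (zzV Wf) p).
    rewrite cG cG' IH; congr (_ ∘ _).
    have [h1 h2] := zz_cancel Wf.
    apply: (iso_inv_uniq (f := mG _ _ (fmap (localization_functor W) f))).
      by rewrite -cG h1 iG.
    by rewrite eloc -cG' h2 iG'.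
apply: functorP => A B f; rewrite -(quotient_reprK f).
by congr arrow; apply: eQ.
Qed.

Lemma localizationP (C : category) (W : mor_class C) :
  is_localization W (localization_functor W).
Proof.
split=> [A B f Wf|D F FW].
  by have [h1 h2] := zz_cancel Wf; exists (fmap (quotient_functor (zz_congruence W))
    (zzV Wf : @hom (zigzag_category W) B A)).
have eG : functor_comp (induced_functor (zz_functor_respects FW))
    (localization_functor W) = F.
  apply: functorP => A B f; congr arrow.
  rewrite -[RHS]compm1.
  exact: (zz_functor_respects FW (quotient_classK (zz_congruence W) (zz1 W f))).
exists (induced_functor (zz_functor_respects FW)); split=> // G' eG'.
by apply: localization_uniq; rewrite eG eG'.
Qed.

(* Main.v *)
(** Choose for every [X] a trivial fibration [QX -> X] with [QX] cofibrant and a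
    trivial cofibration [QX -> RX] with [RX] fibrant.  Lifting a morphism
    [X -> Y] first to [QX -> QY] and then extending it to [RX -> RY] is unique
    up to homotopy, so [R] is a functor from [M] to the homotopy category of
    bifibrant objects.  By Whitehead's theorem it inverts weak equivalences,
    hence factors through [Ho M]; the zigzags [X <- QX -> RX] show that this
    factorization is a quasi-inverse.  Homotopies are extended along trivial
    cofibrations [X -> Y] by means of path objects that lift against them, so
    that neither push-outs nor pull-backs of [M] enter the argument. *)

From mathcomp Require Import all_boot.
From mathcomp Require Import boolp.
Require Import Defs.

Set Implicit Arguments.
Unset Strict Implicit.
Unset Printing Implicit Defensive.

Local Open Scope cat_scope.

(** * Isomorphisms and the category they form *)

Lemma is_iso_comp (C : category) (A B D : C) (g : hom B D) (f : hom A B) :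
  is_iso g -> is_iso f -> is_iso (g ∘ f).
Proof.
move=> [g' [g'g gg']] [f' [f'f ff']]; exists (f' ∘ g'); split.
  by rewrite -compmA [g' ∘ _]compmA g'g comp1m f'f.
by rewrite -compmA [f ∘ _]compmA ff' comp1m gg'.
Qed.

Lemma iso_left_factor (C : category) (A B D : C) (g : hom B D) (f : hom A B) :
  is_iso f -> is_iso (g ∘ f) -> is_iso g.
Proof.
move=> [f' [f'f ff']] gf; rewrite -[g]compm1 -ff' compmA.
by apply: is_iso_comp gf _; exists f.
Qed.

Lemma functor_compA (A B C D : category) (H : functor C D) (G : functor B C)
    (F : functor A B) :
  functor_comp H (functor_comp G F) = functor_comp (functor_comp H G) F.
Proof. exact: functorP. Qed.

Record iso_arrow (D : category) := IsoArrow {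
  iso_dom : D;
  iso_cod : D;
  iso_mor : hom iso_dom iso_cod;
  iso_morP : is_iso iso_mor
}.

Definition iso_square (D : category) (s t : iso_arrow D) : Type :=
  {f : hom (iso_dom s) (iso_dom t) * hom (iso_cod s) (iso_cod t) |
    iso_mor t ∘ f.1 = f.2 ∘ iso_mor s}.

Lemma iso_squareP (D : category) (s t : iso_arrow D) (f g : iso_square s t) :
  (sval f).1 = (sval g).1 -> (sval f).2 = (sval g).2 -> f = g.
Proof.
case: f g => [[f1 f2] ef] [[g1 g2] eg] /= e1 e2.
by case: _ / e1 in eg *; case: _ / e2 in eg *; rewrite (Prop_irrelevance ef eg).
Qed.

Definition iso_square_id (D : category) (s : iso_arrow D) : iso_square s s.
Proof. by exists (idm _, idm _); rewrite compm1 comp1m. Defined.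

Definition iso_square_comp (D : category) (s t u : iso_arrow D)
  (g : iso_square t u) (f : iso_square s t) : iso_square s u.
Proof.
exists ((sval g).1 ∘ (sval f).1, (sval g).2 ∘ (sval f).2) => /=.
by rewrite compmA (svalP g) -compmA (svalP f) compmA.
Defined.

Program Definition iso_arrow_category (D : category) : category :=
  @Category (iso_arrow D) (@iso_square D) (@iso_square_id D)
    (@iso_square_comp D) _ _ _.
Next Obligation. by move=> *; apply: iso_squareP; apply: comp1m. Qed.
Next Obligation. by move=> *; apply: iso_squareP; apply: compm1. Qed.
Next Obligation. by move=> *; apply: iso_squareP; apply: compmA. Qed.

Definition iso_dom_functor (D : category) : functor (iso_arrow_category D) D :=
  @Functor (iso_arrow_category D) D (@iso_dom D) (fun s t f => (sval f).1)
    (fun s => erefl) (fun s t u g f => erefl).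

Definition iso_cod_functor (D : category) : functor (iso_arrow_category D) D :=
  @Functor (iso_arrow_category D) D (@iso_cod D) (fun s t f => (sval f).2)
    (fun s => erefl) (fun s t u g f => erefl).

Lemma iso_dom_cod_iso (C D : category) (H : functor C (iso_arrow_category D)) :
  naturally_isomorphic (functor_comp (iso_dom_functor D) H)
    (functor_comp (iso_cod_functor D) H).
Proof.
exists (fun A => iso_mor (H A)); split=> [A|A B f]; first exact: iso_morP.
exact: svalP (fmap H f).
Qed.

(** * Functors out of a localization *)

(** Both factor [functor_comp G loc], which inverts [W] because functors preserve isomorphisms, and
    such a factorization is unique. *)
Lemma localization_functor_eq (C L D : category) (W : mor_class C)
    (loc : functor C L) (F G : functor L D) :
  is_localization W loc -> functor_comp F loc = functor_comp G loc -> F = G.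
Proof.
move=> [locW ump] e.
have FW : inverts W (functor_comp G loc).
  move=> A B f /locW [g [gf fg]]; exists (fmap G g) => /=.
  by rewrite -!fmap_comp gf fg !fmap_id.
by have [H [_ uH]] := ump D _ FW; rewrite -(uH F e) -(uH G erefl).
Qed.

(* A natural isomorphism [F loc -> G loc] is a functor into the category of
   isomorphisms of [D]; extending it along [loc] yields one [F -> G]. *)
Lemma localization_natural_iso (C L D : category) (W : mor_class C)
    (loc : functor C L) (F G : functor L D) :
  is_localization W loc ->
  naturally_isomorphic (functor_comp F loc) (functor_comp G loc) ->
  naturally_isomorphic F G.
Proof.
move=> hloc [t [ti tn]].
pose sq A B (f : hom A B) : iso_square (IsoArrow (ti A)) (IsoArrow (ti B)) :=
  exist _ (fmap (functor_comp F loc) f, fmap (functor_comp G loc) f) (tn A B f).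
have sq1 A : sq A A (idm A) = iso_square_id (IsoArrow (ti A)).
  by apply: iso_squareP; apply: fmap_id.
have sqM A B E (g : hom B E) (f : hom A B) :
    sq _ _ (g ∘ f) = iso_square_comp (sq _ _ g) (sq _ _ f).
  by apply: iso_squareP; apply: fmap_comp.
pose K : functor C (iso_arrow_category D) :=
  @Functor C (iso_arrow_category D) (fun A => IsoArrow (ti A)) sq sq1 sqM.
have KW : inverts W K.
  move=> A B f Wf; have [g [gf fg]] := hloc.1 _ _ _ Wf.
  have e : t A ∘ fmap F g = fmap G g ∘ t B.
    rewrite -[LHS]comp1m -[X in X ∘ _](fmap_id G) -gf fmap_comp -!compmA.
    congr (_ ∘ _); rewrite compmA -[fmap G _ ∘ _]tn -compmA /=.
    by rewrite -fmap_comp fg fmap_id compm1.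
  exists (exist _ (fmap F g, fmap G g) e).
  by split; apply: iso_squareP => /=; rewrite -fmap_comp ?gf ?fg fmap_id.
have [H [HK _]] := hloc.2 _ K KW.
have -> : F = functor_comp (iso_dom_functor D) H.
  apply: (localization_functor_eq hloc).
  by rewrite -functor_compA HK; apply: functorP.
have -> : G = functor_comp (iso_cod_functor D) H.
  apply: (localization_functor_eq hloc).
  by rewrite -functor_compA HK; apply: functorP.
exact: iso_dom_cod_iso.
Qed.

(** * Lifting and homotopy for trivial fibrations and trivial cofibrations *)

(** By [cofib_llp] it suffices to lift against trivial fibrations, first along [i], then along
    [j]. *)
Lemma cofib_comp (M : category) (S : model_structure M) (A B C : M)
    (i : hom A B) (j : hom B C) :
  CoFib S i -> CoFib S j -> CoFib S (j ∘ i).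
Proof.
move=> ci cj; apply: cofib_llp => X Y p fp wp u v pu.
have [|h [hi ph]] := model_lifting ci fp (or_intror wp) (u := u) (v := v ∘ j).
  by rewrite -compmA.
have [k [kj pk]] := model_lifting cj fp (or_intror wp) ph.
by exists k; rewrite compmA kj hi.
Qed.

Lemma cofibrant_cofib (M : category) (I0 : initial_object M)
    (S : model_structure M) (A B : M) (i : hom A B) :
  cofibrant I0 S A -> CoFib S i -> cofibrant I0 S B.
Proof.
move=> cA ci; rewrite /cofibrant -(@from_initial_uniq _ I0 _ (i ∘ from_initial I0 A)).
exact: cofib_comp cA ci.
Qed.

Lemma fibrant_fib (M : category) (F0 : final_object M)
    (S : model_structure M) (A B : M) (p : hom A B) :
  fibrant F0 S B -> Fib S p -> fibrant F0 S A.
Proof.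
(* In the opposite model category fibrations become cofibrations and the final object becomes
   initial. *)
exact: (@cofibrant_cofib (opposite M) (opposite_initial F0)
          (opposite_model S) B A p).
Qed.

Lemma cofibrant_lift (M : category) (I0 : initial_object M)
    (S : model_structure M) (A X Y : M) (p : hom X Y) (f : hom A Y) :
  cofibrant I0 S A -> trivial_fibration S p -> exists g : hom A X, p ∘ g = f.
Proof.
move=> cA [fp wp].
have [|g [_ pg]] := model_lifting cA fp (or_intror wp)
  (u := from_initial I0 X) (v := f); last by exists g.
exact: etrans (from_initial_uniq _) (esym (from_initial_uniq _)).
Qed.

Lemma fibrant_extension (M : category) (F0 : final_object M)
    (S : model_structure M) (A X Y : M) (i : hom X Y) (f : hom X A) :
  fibrant F0 S A -> trivial_cofibration S i -> exists g : hom Y A, g ∘ i = f.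
Proof.
exact: (@cofibrant_lift (opposite M) (opposite_initial F0)
          (opposite_model S) A Y X i f).
Qed.

(** Factoring the fold map of [A] as [q ∘ j] gives a cylinder. The copairing of [f] and [g] lies
    over the constant homotopy [p ∘ f ∘ q], and lifting this square against [p] gives the
    homotopy. *)
Lemma trivial_fibration_cancel (M : category) (S : model_structure M)
    (A X Y : M) (p : hom X Y) (f g : hom A X) :
  has_finite_coproducts M -> trivial_fibration S p -> p ∘ f = p ∘ g ->
  left_homotopic S f g.
Proof.
move=> hcop [fp wp] pfg; have [T [inj cop]] := hcop bool (fun=> A).
have [d [de _]] := cop A (fun=> idm A).
have [E [j [q [e cj fq wq]]]] := model_factor_tfib S d.
have [u [ue _]] := cop X (fun b => if b then g else f).
have pu : p ∘ u = (p ∘ f ∘ q) ∘ j.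
  have [k [_ ku]] := cop Y (fun b => p ∘ f).
  rewrite -(ku (p ∘ u)); last by move=> []; rewrite -compmA ue.
  by rewrite -(ku (p ∘ f ∘ q ∘ j)) // => b; rewrite -!compmA [q ∘ _]compmA -e de compm1.
have [h [hj _]] := model_lifting cj fp (or_intror wp) pu.
exists E, (j ∘ inj false), (j ∘ inj true), q, h.
by split; rewrite // compmA -?e ?de // hj ue.
Qed.

Lemma trivial_cofibration_cancel (M : category) (S : model_structure M)
    (A X Y : M) (i : hom X Y) (f g : hom Y A) :
  has_finite_products M -> trivial_cofibration S i -> f ∘ i = g ∘ i ->
  right_homotopic S f g.
Proof.
exact: (@trivial_fibration_cancel (opposite M) (opposite_model S) A Y X i f g).
Qed.

Lemma trivial_cofibration_homotopic (M : category) (I0 : initial_object M)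
    (S : model_structure M) (A X Y : M) (i : hom X Y) (f g : hom Y A) :
  has_finite_coproducts M -> has_finite_products M -> cofibrant I0 S X ->
  trivial_cofibration S i -> left_homotopic S (f ∘ i) (g ∘ i) ->
  right_homotopic S f g.
Proof.
move=> hcop hprod cX ti /(good_left_homotopy hcop cX).
move=> [Xt [d0 [d1 [s [h [sd0 sd1 hd0 hd1 t1]]]]]].
have [P [p0 [p1 [c [wc p0c p1c lift]]]]] := good_path_object S A hprod.
(* Lifting along [d1], from constant paths, gives a family of paths [l] between [h] and the constant
   homotopy at [g ∘ i]; hence [l ∘ d0] is a right homotopy from [f ∘ i] to [g ∘ i]. *)
have [||l [l1 pl0 pl1]] := lift _ _ _ (c ∘ g ∘ i) h (g ∘ i ∘ s) t1.
- by rewrite !compmA p0c comp1m hd1.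
- by rewrite !compmA p1c -[RHS]compmA sd1 comp1m compm1.
(* Extend that right homotopy along [i] with the ends [f] and [g] prescribed. *)
have [||k [ki pk0 pk1]] := lift _ _ i (l ∘ d0) f g ti.
- by rewrite compmA pl0.
- by rewrite compmA pl1 -compmA sd0 compm1.
by exists P, p0, p1, c, k.
Qed.

(** * Whitehead's theorem for bifibrant objects *)

Section BifibrantReplacement.
Context (M : category) (I0 : initial_object M) (F0 : final_object M).
Context (hcop : has_finite_coproducts M) (hprod : has_finite_products M).
Context (S : model_structure M).

Local Notation Mcf := (cf_category I0 F0 S).
Local Notation hcong := (homotopy_congruence I0 F0 hcop hprod S).
Local Notation piM := (pi_cf I0 F0 hcop hprod S).
Local Notation "[ f ]" := (fmap (quotient_functor hcong) f).

Lemma right_homotopic_class (A B : Mcf) (f g : hom A B) :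
  @right_homotopic M S (sval A) (sval B) f g -> [f] = [g].
Proof. by move=> /left_right_homotopicP fg; apply/quotient_classP/fg. Qed.

(** Lifting the identity gives a section [s]; since [s ∘ p] and the identity agree after composition
    with [p], they are homotopic. *)
Lemma trivial_fibration_iso (A B : Mcf) (p : hom A B) :
  @trivial_fibration M S (sval A) (sval B) p -> is_iso [p].
Proof.
move=> tp; have [s ps] := cofibrant_lift (idm (sval B)) (svalP B).1 tp.
exists (fmap (quotient_functor hcong) (s : @hom Mcf B A)).
split; rewrite -fmap_comp; last by rewrite [p ∘ _]ps.
apply/quotient_classP; apply: (trivial_fibration_cancel hcop tp).
by rewrite [LHS]compmA ps comp1m [RHS]compm1.
Qed.

Lemma trivial_cofibration_iso (A B : Mcf) (i : hom A B) :
  @trivial_cofibration M S (sval A) (sval B) i -> is_iso [i].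
Proof.
move=> ti; have [s si] := fibrant_extension (idm (sval A)) (svalP A).2 ti.
exists (fmap (quotient_functor hcong) (s : @hom Mcf B A)).
split; rewrite -fmap_comp; first by rewrite [_ ∘ i]si.
apply: right_homotopic_class; apply: (trivial_cofibration_cancel hprod ti).
by rewrite -[LHS]compmA si compm1 [RHS]comp1m.
Qed.

(** Factor [f] as a trivial cofibration and a fibration, the latter trivial by two out of three. The
    middle object is cofibrant because [A] is and fibrant because [B] is, so both factors are
    isomorphisms up to homotopy. *)
Lemma whitehead (A B : Mcf) (f : hom A B) :
  @Weq M S (sval A) (sval B) f -> is_iso [f].
Proof.
move=> wf; have [E [i [p [e ci wi fp]]]] := model_factor_tcof S (f : @hom M _ _).
have wp : Weq S p by apply: weq_cancelr wi _; rewrite -e.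
pose Ecf : Mcf := exist _ E
  (conj (cofibrant_cofib (svalP A).1 ci) (fibrant_fib (svalP B).2 fp)).
have -> : f = (p : @hom Mcf Ecf B) ∘ (i : @hom Mcf A Ecf) := e.
rewrite fmap_comp; apply: is_iso_comp.
  exact: trivial_fibration_iso.
exact: trivial_cofibration_iso.
Qed.

(** * Bifibrant replacement as a functor *)

Record replacement (X : M) := Replacement {
  rep_mid : M;
  rep_mid_cof : cofibrant I0 S rep_mid;
  rep_proj : hom rep_mid X;
  rep_projP : trivial_fibration S rep_proj;
  rep_ob : Mcf;
  rep_inj : hom rep_mid (sval rep_ob);
  rep_injP : trivial_cofibration S rep_inj
}.

Lemma replacement_exists (X : M) : exists _ : replacement X, True.
Proof.
have [Q [i [q [ei ci fq wq]]]] := model_factor_tfib S (from_initial I0 X).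
have cQ : cofibrant I0 S Q by rewrite /cofibrant -(from_initial_uniq i).
have [R [j [p [ej cj wj fp]]]] := model_factor_tcof S (to_final F0 Q).
have fR : fibrant F0 S R by rewrite /fibrant -(to_final_uniq p).
by exists (@Replacement X Q cQ q (conj fq wq)
  (exist _ R (conj (cofibrant_cofib cQ cj) fR)) j (conj cj wj)).
Qed.

Definition rep (X : M) : replacement X := sval (cid (replacement_exists X)).

Local Notation q X := (rep_proj (rep X)).
Local Notation r X := (rep_inj (rep X)).
Local Notation R X := (rep_ob (rep X)).

(** A relation rather than a chosen map: identities and composites visibly satisfy it, so
    functoriality follows from uniqueness up to homotopy. *)
Definition rep_lift (X Y : M) (f : hom X Y) (phi : hom (R X) (R Y)) : Prop :=
  exists g : hom (rep_mid (rep X)) (rep_mid (rep Y)),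
    q Y ∘ g = f ∘ q X /\ (phi : @hom M _ _) ∘ r X = r Y ∘ g.

Lemma rep_lift_exists (X Y : M) (f : hom X Y) :
  exists phi : hom (R X) (R Y), rep_lift f phi.
Proof.
have [g qg] :=
  cofibrant_lift (f ∘ q X) (rep_mid_cof (rep X)) (rep_projP (rep Y)).
have [phi phir] :=
  fibrant_extension (r Y ∘ g) (svalP (R Y)).2 (rep_injP (rep X)).
by exists phi, g.
Qed.

(** The two middle lifts agree after [q Y], hence are homotopic; composing with [r Y] gives a
    homotopy that extends along [r X]. *)
Lemma rep_lift_uniq (X Y : M) (f : hom X Y) (phi psi : hom (R X) (R Y)) :
  rep_lift f phi -> rep_lift f psi -> [phi] = [psi].
Proof.
move=> [g [qg phir]] [k [qk psir]]; apply: right_homotopic_class.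
apply: (trivial_cofibration_homotopic hcop hprod
  (rep_mid_cof (rep X)) (rep_injP (rep X))).
rewrite phir psir; apply: left_homotopic_postcomp.
by apply: (trivial_fibration_cancel hcop (rep_projP (rep Y))); rewrite qg qk.
Qed.

Lemma rep_lift_id (X : M) : rep_lift (idm X) (idm (R X)).
Proof. by exists (idm _); rewrite !compm1 comp1m; split=> //; apply: comp1m. Qed.

Lemma rep_lift_comp (X Y Z : M) (g : hom Y Z) (f : hom X Y) psi phi :
  rep_lift g psi -> rep_lift f phi -> rep_lift (g ∘ f) (psi ∘ phi).
Proof.
move=> [g' [qg psir]] [f' [qf phir]]; exists (g' ∘ f'); split.
  by rewrite compmA qg -compmA qf compmA.
by rewrite -[LHS]compmA phir !compmA psir.
Qed.

Definition rep_map (X Y : M) (f : hom X Y) : hom (R X) (R Y) :=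
  sval (cid (rep_lift_exists f)).

Lemma rep_mapP (X Y : M) (f : hom X Y) : rep_lift f (rep_map f).
Proof. exact: svalP (cid (rep_lift_exists f)). Qed.

Lemma rep_map_id (X : M) : [rep_map (idm X)] = idm (R X : piM).
Proof.
rewrite -[RHS](fmap_id (quotient_functor hcong)).
exact: rep_lift_uniq (rep_mapP _) (rep_lift_id X).
Qed.

Lemma rep_map_comp (X Y Z : M) (g : hom Y Z) (f : hom X Y) :
  [rep_map (g ∘ f)] = [rep_map g] ∘ [rep_map f].
Proof.
rewrite -fmap_comp.
exact: rep_lift_uniq (rep_mapP _) (rep_lift_comp (rep_mapP g) (rep_mapP f)).
Qed.

Definition rep_functor : functor M piM :=
  @Functor M piM (fun X => R X) (fun X Y f => [rep_map f])
    rep_map_id rep_map_comp.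

(** Two out of three passes from [f] to the middle lift through the projections [q], then to
    [rep_map f] through the injections [r]. *)
Lemma rep_functor_inverts : inverts (Weq S) rep_functor.
Proof.
move=> X Y f wf; apply: whitehead; have [g [qg phir]] := rep_mapP f.
apply: (weq_cancelr (rep_injP (rep X)).2); rewrite phir.
apply: weq_comp (rep_injP (rep Y)).2.
apply: (weq_cancell (rep_projP (rep Y)).2); rewrite qg.
exact: weq_comp (rep_projP (rep X)).2 wf.
Qed.

(** * Comparison of the replacement with the identity and with the localization *)

Lemma rep_ext_exists (X : Mcf) :
  exists e : hom (R (sval X)) X,
    (e : @hom M _ _) ∘ r (sval X) = q (sval X).
Proof. exact: fibrant_extension (svalP X).2 (rep_injP (rep (sval X))). Qed.

Lemma rep_functor_cf_iso (K : functor piM piM) :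
  functor_comp K (quotient_functor hcong)
    = functor_comp rep_functor (cf_inclusion I0 F0 S) ->
  naturally_isomorphic K (functor_id piM).
Proof.
move=> eK.
have resp : respects hcong (functor_comp rep_functor (cf_inclusion I0 F0 S)).
  by move=> X Y f g /quotient_classP fg; rewrite -eK /= fg.
(* The explicit functor sends [X] to [R (sval X)] by computation, so the classes of the maps [e X]
   have the right type to be its components. *)
have -> : K = induced_functor resp.
  apply: functorP => X Y f; rewrite -(quotient_reprK f).
  rewrite [arrow (fmap (induced_functor _) _)]/arrow.
  rewrite (induced_functorE resp (quotient_repr f)).
  exact: (arrow_fmap (quotient_repr f) eK).
pose e X := sval (cid (rep_ext_exists X)).
have er X : (e X : @hom M _ _) ∘ r (sval X) = q (sval X).
  exact: svalP (cid (rep_ext_exists X)).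
exists (fun X => [e X]); split=> [X|X Y f].
  apply: whitehead; apply: (weq_cancelr (rep_injP (rep (sval X))).2).
  by rewrite er; apply: (rep_projP _).2.
rewrite -(quotient_reprK f); move: (quotient_repr f) => {}f.
(* Naturality holds only up to homotopy: both sides agree strictly after precomposition with the
   trivial cofibration [r]. *)
have ef : [e Y ∘ rep_map (f : @hom M _ _)] = [f ∘ e X].
  apply: right_homotopic_class.
  apply: (trivial_cofibration_cancel hprod (rep_injP (rep (sval X)))).
  have [g [qg phir]] := rep_mapP (f : @hom M _ _).
  by rewrite -[LHS]compmA phir compmA er qg -[RHS]compmA er.
rewrite (induced_functorE resp f).
exact: etrans (esym (fmap_comp _ _ _)) (etrans ef (fmap_comp _ _ _)).
Qed.

Lemma rep_functor_loc_iso (Ho : category) (loc : functor M Ho)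
    (resp : respects hcong (functor_comp loc (cf_inclusion I0 F0 S))) :
  inverts (Weq S) loc ->
  naturally_isomorphic (functor_comp (induced_functor resp) rep_functor) loc.
Proof.
move=> locW.
(* The component at [X] is the span from [R X] to [X] read in [Ho], the leg [r X] being inverted. *)
have ext X : exists t : hom (loc (sval (R X))) (loc X),
    t ∘ fmap loc (r X) = fmap loc (q X).
  have [r' [r'r _]] := locW _ _ _ (rep_injP (rep X)).2.
  by exists (fmap loc (q X) ∘ r'); rewrite -compmA r'r compm1.
pose t X := sval (cid (ext X)).
have tr X : t X ∘ fmap loc (r X) = fmap loc (q X) := svalP (cid (ext X)).
exists t; split=> [X|X Y f].
  apply: (iso_left_factor (locW _ _ _ (rep_injP (rep X)).2)).
  by rewrite tr; apply: locW (rep_projP _).2.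
(* Since [fmap loc (r X)] is invertible, naturality may be checked after precomposition with it. *)
have [r' [_ rr']] := locW _ _ _ (rep_injP (rep X)).2.
rewrite -[LHS]compm1 -[RHS]compm1 -rr' !compmA; congr (_ ∘ _).
have [g [qg phir]] := rep_mapP f.
rewrite [fmap (functor_comp _ _) f](induced_functorE resp) -[RHS]compmA tr.
have phiL : fmap loc (rep_map f : @hom M _ _) ∘ fmap loc (r X)
    = fmap loc (r Y) ∘ fmap loc g by rewrite -!fmap_comp phir.
by rewrite -[LHS]compmA [X in _ ∘ X]phiL compmA tr -!fmap_comp qg.
Qed.

(** The two ends [d0] and [d1] of the cylinder are sections of the same [s], which becomes
    invertible, so they have the same image. *)
Lemma inverts_left_homotopic (Ho : category) (loc : functor M Ho) (A B : M)
    (f g : hom A B) :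
  inverts (Weq S) loc -> left_homotopic S f g -> fmap loc f = fmap loc g.
Proof.
move=> locW [At [d0 [d1 [s [h [ws sd0 sd1 <- <-]]]]]].
have [t [ts st]] := locW _ _ _ ws.
rewrite !fmap_comp; congr (_ ∘ _).
rewrite -[LHS]comp1m -[RHS]comp1m -ts -!compmA -!fmap_comp.
by rewrite sd0 sd1.
Qed.

End BifibrantReplacement.

Theorem theorem1p2 (M : category)
  (I0 : initial_object M) (F0 : final_object M)
  (hcop : has_finite_coproducts M) (hprod : has_finite_products M)
  (S : model_structure M)
  (hpush : forall (A B C : M) (i : hom A B) (u : hom A C),
     trivial_cofibration S i ->
     exists (D : M) (w : hom B D) (i' : hom C D),
       weak_pushout u i w i' /\ trivial_cofibration S i')
  (hpull : forall (B C D : M) (p : hom C D) (v : hom B D),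
     trivial_fibration S p ->
     exists (A : M) (p' : hom A B) (w : hom A C),
       weak_pullback w p' v p /\ trivial_fibration S p')
  (Ho : category) (loc : functor M Ho)
  (hloc : is_localization (Weq S) loc) :
  exists hresp : respects (homotopy_congruence I0 F0 hcop hprod S)
                   (functor_comp loc (cf_inclusion I0 F0 S)),
    is_equivalence
      (induced_functor hresp : functor (pi_cf I0 F0 hcop hprod S) Ho).
Proof.
have hresp : respects (homotopy_congruence I0 F0 hcop hprod S)
    (functor_comp loc (cf_inclusion I0 F0 S)).
  by move=> A B f g; apply: (inverts_left_homotopic hloc.1).
(* The quasi-inverse [G] is the factorization of [rep_functor] through [loc]. *)
have [G [eG _]] := hloc.2 _ _ (@rep_functor_inverts _ I0 F0 hcop hprod S).
exists hresp, G; split.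
  apply: rep_functor_cf_iso; rewrite -eG -!functor_compA; congr functor_comp.
  by apply: functorP => A B f; congr arrow; apply: (induced_functorE hresp f).
(* It is enough to compare with the identity of [Ho] after precomposition with [loc], where [G]
   becomes [rep_functor]. *)
apply: (localization_natural_iso hloc); rewrite -functor_compA eG.
have -> : functor_comp (functor_id Ho) loc = loc by apply: functorP.
exact: rep_functor_loc_iso hloc.1.
Qed.
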